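(* Any $\mathcal{F}_2$-protocol with parameters $n,k,\ell$ and linear decoding must satisfy $\binom{n}{\ell}2^\ell\ge 2^k$.
   Context: Let $\mathcal{F}_2=\bigcup_{a\neq b}\mathcal{F}_{\{a,b\}}$ (union over distinct $a,b\in\mathbb{R}$), where $\mathcal{F}_{\{a,b\}}=\{f(\mathbf{x})=\mathbf{w}\mathbf{x}^\intercal\mid\mathbf{w}\in\{a,b\}^k\}$. An $\mathcal{F}_2$-protocol with parameters $n,k,\ell$ (positive integers, $n\ge k$, $\ell\le n$) consists of a linear encoding $\mathbb{R}^k\to\mathbb{R}^n$, $\mathbf{x}\mapsto\mathbf{y}=(y_1,\dots,y_n)$ (each $y_i$ is a fixed linear combination of the entries of $\mathbf{x}$, stored on server $i$), together with, for every $f\in\mathcal{F}_2$, a set of $\ell$ of the $n$ servers (depending only on $f$) and a way to compute $f(\mathbf{x})$ from the contents of these $\ell$ servers, for every $\mathbf{x}\in\mathbb{R}^k$. The protocol has linear decoding if $f(\mathbf{x})$ is always obtained as a linear combination, with real coefficients depending only on $f$, of the $\ell$ downloaded entries of $\mathbf{y}$. *)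

(* Defs.v *)
From mathcomp Require Import all_boot all_order all_algebra.
From mathcomp Require Import classical_sets reals.

Set Implicit Arguments.
Unset Strict Implicit.
Unset Printing Implicit Defensive.

Import GRing.Theory.

Local Open Scope classical_set_scope.
Local Open Scope ring_scope.

Definition two_valued (R : realType) (k : nat) (a b : R) : set ('rV[R]_k -> R) :=
  [set f | exists w : 'rV[R]_k,
     (forall i, w 0 i = a \/ w 0 i = b) /\
     (forall x, f x = (w *m x^T) 0 0)].

Definition F2 (R : realType) (k : nat) : set ('rV[R]_k -> R) :=
  \bigcup_(ab in [set ab : R * R | ab.1 <> ab.2]) @two_valued R k ab.1 ab.2.

Definition download (R : realType) (n : nat) (S : {set 'I_n}) (y : 'rV[R]_n) :
    {ffun {i : 'I_n | i \in S} -> R} :=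
  [ffun i => y 0 (val i)].

(* [servers] and [decode] are total in [f] for convenience only: their values
   are unconstrained, and never used, outside [F2]. *)
Record F2_protocol (R : realType) (n k l : nat) := F2Protocol {
  encode : {linear 'rV[R]_k -> 'rV[R]_n};
  servers : ('rV[R]_k -> R) -> {set 'I_n};
  decode : forall f : 'rV[R]_k -> R,
    {ffun {i : 'I_n | i \in servers f} -> R} -> R;
  card_servers : forall f, @F2 R k f -> #|servers f| = l;
  decodeK : forall f, @F2 R k f ->
    forall x, decode (download (servers f) (encode x)) = f x
}.

(* The coefficients [c] may depend on [f], but not on the data [x]. Linearity
   is only required on data that the servers can actually hold. *)
Definition linear_decoding (R : realType) (n k l : nat)
    (P : F2_protocol R n k l) : Prop :=
  forall f, @F2 R k f ->
    exists c : {ffun {i : 'I_n | i \in servers P f} -> R},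
      forall x, let d := download (servers P f) (encode P x) in
        decode d = \sum_i c i * d i.

(* Main.v *)
(** Restrict to 0/1 weights. A weight decodable from the servers [S] lies in the
    span of the encoding columns indexed by [S], a space of dimension at most
    [l]; a space of dimension [r] contains at most [2 ^ r] vectors with entries
    in {0, 1}, since [r] suitable coordinates determine each of its vectors. *)
Require Import Defs.
From mathcomp Require Import all_boot all_order all_algebra.
From mathcomp Require Import classical_sets reals.

Import GRing.Theory.
Local Open Scope ring_scope.

Definition bool_row (F : fieldType) (k : nat) (g : {ffun 'I_k -> bool}) :
  'rV[F]_k := \row_i (g i)%:R.

Lemma card_bool_row_submx (F : fieldType) (m k : nat) (M : 'M[F]_(m, k)) :
  (#|[set g | (bool_row F k g <= M)%MS]| <= 2 ^ m)%N.
Proof.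
(* [f] picks linearly independent columns of [M] that span all its columns; [D] will hold the
   coefficients. *)
pose f := maxrankfun M^T.
have [D eqM] : exists D, M = colsub f M *m D.
  have /submxP[D eqMT] : (M^T <= rowsub f M^T)%MS by rewrite (eq_maxrowsub M^T).
  by exists D^T; apply: trmx_inj; rewrite trmx_mul trmxK trmx_mxsub.
pose h (g : {ffun 'I_k -> bool}) := [ffun j => g (f j)].
(* A row [u *m M] equals [(u *m colsub f M) *m D], so its entries at the positions [f] recover all
   the others. *)
have h_inj : {in [set g | (bool_row F k g <= M)%MS] &, injective h}.
  have rowE g : (bool_row F k g <= M)%MS ->
      bool_row F k g = colsub f (bool_row F k g) *m D.
    by case/submxP=> u ->; rewrite {1}eqM mulmxA mulmx_colsub.
  move=> g1 g2; rewrite !inE => /rowE g1E /rowE g2E eq_h.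
  have: bool_row F k g1 = bool_row F k g2.
    rewrite g1E g2E; congr (_ *m _); apply/rowP=> j; rewrite !mxE.
    by have /ffunP/(_ j) := eq_h; rewrite !ffunE => ->.
  move/rowP=> eq_g; apply/ffunP=> i; have := eq_g i; rewrite !mxE.
  by case: (g1 i) (g2 i) => [] [] // /eqP; rewrite ?oner_eq0 // eq_sym oner_eq0.
rewrite -(card_in_imset h_inj); apply: leq_trans (max_card _) _.
rewrite card_ffun card_bool card_ord leq_pexp2l // mxrank_tr.
exact: rank_leq_row.
Qed.

Lemma F2_bool_row (R : realType) (k : nat) (g : {ffun 'I_k -> bool}) :
  F2 (fun x : 'rV[R]_k => (bool_row R k g *m x^T) 0 0).
Proof.
exists (0, 1) => /=; first by move/eqP; rewrite eq_sym oner_eq0.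
exists (bool_row R k g); split=> // i.
by rewrite mxE; case: (g i); [right | left].
Qed.

(** Row [i] of the transposed encoding matrix is the linear form stored on server [i]. Decoding at
    the standard basis vectors reads off the entries of [w] as combinations of these forms, with the
    decoding coefficients. *)
Lemma linear_decoding_submx (R : realType) (n k l : nat)
    (P : F2_protocol R n k l) (linP : linear_decoding P) (w : 'rV[R]_k)
    (f := fun x : 'rV[R]_k => (w *m x^T) 0 0) (F2f : F2 f) :
  (w <= rowsub (@enum_val _ (mem (servers P f))) (lin1_mx (encode P))^T)%MS.
Proof.
have [c cE] := linP f F2f; set S := servers P f in c cE *.
set A := (lin1_mx (encode P))^T.
have -> : w = \sum_i c i *: row (val i) A.
  apply/rowP=> j; have := decodeK P F2f (delta_mx 0 j); rewrite cE /f.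
  rewrite trmx_delta -colE mxE => <-; rewrite summxE; apply: eq_bigr => i _.
  by rewrite !mxE ffunE.
apply: summx_sub => -[i iS] _; apply: scalemx_sub => /=.
(* Servers index the sum, but ranks in the enumeration of [S] index the rows of [rowsub]. *)
by rewrite -(enum_rankK_in iS iS) -row_rowsub row_sub.
Qed.

Theorem theorem3 (R : realType) (n k l : nat)
    (n_gt0 : (0 < n)%N) (k_gt0 : (0 < k)%N) (l_gt0 : (0 < l)%N)
    (le_kn : (k <= n)%N) (le_ln : (l <= n)%N)
    (P : F2_protocol R n k l) (linP : linear_decoding P) :
  (2 ^ k <= 'C(n, l) * 2 ^ l)%N.
Proof.
pose f (g : {ffun 'I_k -> bool}) (x : 'rV[R]_k) := (bool_row R k g *m x^T) 0 0.
have F2f g : F2 (f g) := F2_bool_row R k g.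
have <- : #|{ffun 'I_k -> bool}| = (2 ^ k)%N.
  by rewrite card_ffun card_bool card_ord.
rewrite -sum1_card.
(* Group the 0/1 weights by the server set that decodes them: with ['C(n, l)] possible sets, it
   suffices to bound each group by [2 ^ l]. *)
rewrite (partition_big (servers P \o f) (fun S => #|S| == l)) /=; last first.
  by move=> g _; rewrite (card_servers P (F2f g)).
have <- : (\sum_(S : {set 'I_n} | #|S| == l) 2 ^ l = 'C(n, l) * 2 ^ l)%N.
  by rewrite sum_nat_cond_const -[in RHS](card_ord n) -card_draws cardsE.
(* The exponent becomes [#|S|], the number of rows of the matrix [M] below. *)
apply: leq_sum => S /eqP cardS; rewrite sum1dep_card -[X in (_ <= 2 ^ X)%N]cardS.
pose M := rowsub (@enum_val _ (mem S)) (lin1_mx (encode P))^T.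
apply: leq_trans (card_bool_row_submx _ _ _ M).
apply/subset_leq_card/fintype.subsetP=> g; rewrite !inE {}/M => /eqP <-.
exact: linear_decoding_submx _ _ _ _ P linP _ (F2f g).
Qed.
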